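(* The sand automaton $\Gamma : X \to X$ is not surjective on $\mathcal{P}$; that is, it is not the case that for every $\mathbf{y}\in\mathcal{P}$ there is $\mathbf{y}'\in\mathcal{P}$ with $\Gamma(\mathbf{y}')=\mathbf{y}$. Consequently $\Gamma : X\to X$ is not surjective.
   Context: Let $\widetilde{\mathbb{Z}}=\mathbb{Z}\cup\{-\infty,+\infty\}$ and $X=\widetilde{\mathbb{Z}}^{\mathbb{Z}}$. Identify $\mathbb{Z}_5$ with $\{-2,-1,0,1,2\}$ and let $\oplus$ denote addition mod $5$ with representatives in this set. For $m\in\mathbb{Z}$ and $n\in\widetilde{\mathbb{Z}}$ let the clamped gradient $\delta_m(n)\in\{-2,\dots,2\}$ be $2$ if $n>m+1$, $-2$ if $n<m-1$, and $n-m$ otherwise. The sand automaton $\Gamma:X\to X$ is defined by $\Gamma(\mathbf{x})_i=x_i$ if $x_i=\pm\infty$, and, if $x_i\in\mathbb{Z}$, $$\Gamma(\mathbf{x})_i=x_i+\bigl(\delta_{x_i}(x_{i-1})\oplus\delta_{x_i}(x_{i+1})\bigr),$$ where the outer sum is taken in $\mathbb{Z}$. Let $\sigma:X\to X$ be the shift, $(\sigma(\mathbf{x}))_n=x_{n+1}$. $\mathcal{P}$ is the set of all $\sigma$-periodic configurations in $X$ all of whose entries are finite. *)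

(* Defs.v *)
From HB Require Import structures.
From mathcomp Require Import all_boot all_order all_algebra.
From mathcomp Require Import classical_sets functions constructive_ereal.

Set Implicit Arguments.
Unset Strict Implicit.
Unset Printing Implicit Defensive.

Import Order.TTheory GRing.Theory Num.Theory.
Local Open Scope classical_set_scope.
Local Open Scope ring_scope.

Definition config : Type := int -> \bar int.

Definition shift (x : config) : config := fun n => x (n + 1).

(* The element of {-2, -1, 0, 1, 2} congruent to a + b modulo 5: the offset by 2
   turns the representatives {0, ..., 4} given by %% into centred ones. *)
Definition oplus5 (a b : int) : int := ((a + b + 2) %% 5)%Z - 2.

Lemma oplus5_mod (a b : int) : (oplus5 a b = a + b %[mod 5])%Z.
Proof. by rewrite /oplus5 modzDml addrK. Qed.

Lemma oplus5_range (a b : int) : -2 <= oplus5 a b <= 2.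
Proof.
rewrite /oplus5 lerBrDr lerBlDr modz_ge0 //=.
by rewrite -ltzD1 ltz_pmod.
Qed.

(* In the last branch n is finite, so [fine n] is its integer value. *)
Definition delta (m : int) (n : \bar int) : int :=
  if ((m + 1)%:E < n)%E then 2
  else if (n < (m - 1)%:E)%E then -2
  else fine n - m.

Definition Gamma (x : config) : config := fun i =>
  if x i is m%:E then
    (m + oplus5 (delta m (x (i - 1))) (delta m (x (i + 1))))%:E
  else x i.

Definition shift_periodic (x : config) : Prop :=
  exists2 p : nat, (0 < p)%N & iter p shift x = x.

Definition finite_periodic : set config :=
  [set x | shift_periodic x /\ forall i, x i \is a fin_num].

(* Main.v *)
Require Import Defs.
From mathcomp Require Import all_boot all_order all_algebra.
From mathcomp Require Import classical_sets functions constructive_ereal.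
From mathcomp Require Import boolp zify.

(** The automaton has an orphan: the block of heights [m + 8, m + 2, m, m + 3]
    never occurs in an image [Gamma x] ([Gamma_orphan]). The reason is that an
    update changes a height by at most 2 and that a difference of at least 2
    between neighbours is only seen as [2] or [-2].

    Let [a, b, c, e] be the heights in [x] that would become this block. The drop
    of 6 from the first to the second forces [b + 2 <= a], so the second
    cell sees exactly [2] on its left, whatever [a] is. Its update therefore
    depends on [c] alone, which confines [(b, c)] to [(m, m)], [(m + 1, m)] and
    the pairs [(m + 2, c)] with [m - 2 <= c <= m] ([orphan_left]). In each of
    these cases the update of the third cell determines what that cell must see
    on its right, namely a height [e <= m]. But [e] is at least
    [m + 1], as it becomes [m + 3] in one step.

    Infinite heights are fixed by [Gamma], so a preimage of finite heights is
    finite, and the argument covers all configurations. Repeating the block with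
    period 4 gives a single finite periodic configuration that has no preimage at
    all; this refutes both surjectivity claims. *)

Import Order.TTheory GRing.Theory Num.Theory.
Local Open Scope ring_scope.

(** Presents the sum mod 5 by linear constraints only, so that a case analysis on
    the clamped differences leaves goals of linear integer arithmetic. *)
Lemma oplus5_spec (a b : int) :
  exists k : int, oplus5 a b = a + b - 5 * k /\ -2 <= oplus5 a b <= 2.
Proof.
exists ((a + b + 2) %/ 5)%Z; split; last exact: oplus5_range.
by have := divz_eq (a + b + 2) 5; rewrite /oplus5; lia.
Qed.

Lemma delta_finP (m n : int) :
  [\/ m + 1 < n /\ delta m n%:E = 2, n < m - 1 /\ delta m n%:E = -2
    | m - 1 <= n <= m + 1 /\ delta m n%:E = n - m].
Proof.
rewrite /delta !lte_fin; case: ifP => [|mn]; first by constructor 1.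
case: ifP => [|nm]; first by constructor 2.
by constructor 3; split => //; lia.
Qed.

(** Infinite entries are fixed, so they cannot be the origin of a finite one. *)
Lemma Gamma_fin_inv (x : config) (i n : int) : Gamma x i = n%:E ->
  exists2 m : int, x i = m%:E
    & n = m + oplus5 (delta m (x (i - 1))) (delta m (x (i + 1))).
Proof.
rewrite {1}/Gamma; case xi: (x i) => [m||] // [<-].
by exists m.
Qed.

(** With left neighbour at least 2 higher, the step [t] of the middle cell [b]
    satisfies [t = 2 + delta b c] mod 5. Since the target of [c] is 2 below that
    of [b], [t = -2] and [t = -1], which require [c > b], would need
    [c] to fall by 5 or more. *)
Lemma orphan_left (m a b c : int) : b + 2 <= a -> m - 2 <= c <= m + 2 ->
  b + oplus5 (delta b a%:E) (delta b c%:E) = m + 2 ->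
  [\/ b = m /\ c = m, b = m + 1 /\ c = m | b = m + 2 /\ m - 2 <= c <= m].
Proof.
move=> ba c_range bE.
have [k [kE k_range]] := oplus5_spec (delta b a%:E) (delta b c%:E).
have uE : delta b a%:E = 2 by case: (delta_finP b a); lia.
case: (delta_finP b c) => -[v_range vE].
- lia.
- by constructor 3; lia.
- have [bm|bm] : b = m \/ b = m + 1 by lia.
  + by constructor 1; lia.
  + by constructor 2; lia.
Qed.

(** In every case left by [orphan_left], the third cell sees on its right one of
    the values [0], [-1], [-2] and so [e <= m]. *)
Lemma orphan_right (m b c e : int) :
  [\/ b = m /\ c = m, b = m + 1 /\ c = m | b = m + 2 /\ m - 2 <= c <= m] ->
  c + oplus5 (delta c b%:E) (delta c e%:E) = m -> e <= m.
Proof.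
move=> bc cE.
have [k [kE k_range]] := oplus5_spec (delta c b%:E) (delta c e%:E).
by case: (delta_finP c e) (delta_finP c b) bc => -[? ?] [] [? ?] [] [? ?]; lia.
Qed.

Lemma Gamma_orphan (x : config) (i m : int) :
  Gamma x i = (m + 8)%:E -> Gamma x (i + 1) = (m + 2)%:E ->
  Gamma x (i + 2) = m%:E -> Gamma x (i + 3) = (m + 3)%:E -> False.
Proof.
move=> /Gamma_fin_inv[a xa aE] /Gamma_fin_inv[b xb bE].
move=> /Gamma_fin_inv[c xc cE] /Gamma_fin_inv[e xe eE].
have a_range := oplus5_range (delta a (x (i - 1))) (delta a (x (i + 1))).
have e_range := oplus5_range (delta e (x (i + 3 - 1))) (delta e (x (i + 3 + 1))).
have b_range := oplus5_range (delta b (x (i + 1 - 1))) (delta b (x (i + 1 + 1))).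
have c_range := oplus5_range (delta c (x (i + 2 - 1))) (delta c (x (i + 2 + 1))).
have ba : b + 2 <= a by lia.
have cm : m - 2 <= c <= m + 2 by lia.
move: bE cE.
rewrite addrK xa (_ : i + 1 + 1 = i + 2) ?xc; last by lia.
rewrite (_ : i + 2 - 1 = i + 1) ?xb; last by lia.
rewrite (_ : i + 2 + 1 = i + 3) ?xe; last by lia.
move=> /esym bE /esym cE.
have em : e <= m by apply: orphan_right cE; apply: orphan_left ba cm bE.
lia.
Qed.

Definition orphan_config : config :=
  fun i => (nth 0 [:: 8; 2; 0; 3] `|(i %% 4)%Z|)%:E.

Lemma orphan_config_no_preimage (x : config) : Gamma x <> orphan_config.
Proof.
by move=> xE; apply: (@Gamma_orphan x 0 0); rewrite xE.
Qed.

Lemma orphan_config_periodic : finite_periodic orphan_config.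
Proof.
split=> [|i]; last by [].
exists 4 => //; apply/funext => i.
rewrite /= /shift /orphan_config; congr (nth _ _ `| _ |)%:E.
by rewrite -!addrA modzDr.
Qed.

Theorem proposition3p3 :
  ~ set_surj finite_periodic finite_periodic Gamma /\
  ~ set_surj [set: config]%classic [set: config]%classic Gamma.
Proof.
split=> Gamma_surj.
- have [x _] := Gamma_surj _ orphan_config_periodic.
  exact: orphan_config_no_preimage.
- have [x _] := Gamma_surj orphan_config I.
  exact: orphan_config_no_preimage.
Qed.
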